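(* Let $\lambda$ be a partition of $n$ such that $P_\lambda$ is not a chain (i.e. $\lambda_1\ge2$ and $\lambda$ has at least two parts). Then $\delta(P_\lambda)\le\frac13$. Moreover, $\delta(P_\lambda;x,y)\le\frac13$ for some cells $x=(1,k)\in\lambda$ and $y=(\ell,1)\in\lambda$.
   Context: For a finite poset $P=(X,\prec)$, a linear extension is an order-preserving bijection $L:X\to\{1,\ldots,|X|\}$. For distinct $x,y\in X$ let $\delta(P;x,y)=\bigl|\mathbf{P}[L(x)<L(y)]-\mathbf{P}[L(y)<L(x)]\bigr|$ with $L$ a uniformly random linear extension, and $\delta(P)=\min_{x\ne y}\delta(P;x,y)$. For a partition $\lambda$, $P_\lambda$ is the poset on the cells $(i,j)$, $1\le j\le\lambda_i$, of its Young diagram with $(i,j)\preceq(i',j')$ iff $i\le i'$ and $j\le j'$. *)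

(* Defs.v *)
From HB Require Import structures.
From mathcomp Require Import all_boot all_order all_algebra.

Set Implicit Arguments.
Unset Strict Implicit.
Unset Printing Implicit Defensive.

Import Order.TTheory GRing.Theory Num.Theory.

Local Open Scope ring_scope.

Section Posets.
Context {d : Order.disp_t} {T : finPOrderType d}.
Implicit Types (x y : T) (L : {ffun T -> 'I_#|T|}).

(* The labels are 0, ..., |T| - 1 rather than 1, ..., |T|. *)
Definition linear_extension L : bool :=
  [&& injectiveb L, [forall k, k \in codom L]
    & [forall x, forall y, (x < y)%O ==> (L x < L y)%N]].

Definition prob_linext (E : pred {ffun T -> 'I_#|T|}) : rat :=
  #|[set L | linear_extension L && E L]|%:R / #|[set L | linear_extension L]|%:R.

Definition delta_pair x y : rat :=
  `| prob_linext (fun L => (L x < L y)%N) - prob_linext (fun L => (L y < L x)%N) |.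

End Posets.

(* Every delta_pair x y is at most 1, so the default value 1 of the iterated
   minimum is relevant only when T has no two distinct elements. *)
Definition delta {d : Order.disp_t} (T : finPOrderType d) : rat :=
  \big[Num.min/1]_(p : T * T | p.1 != p.2) delta_pair p.1 p.2.

Definition chain {d : Order.disp_t} (T : porderType d) : Prop :=
  forall x y : T, (x >=< y)%O.

Definition partition_of (n : nat) (la : seq nat) : bool :=
  [&& sorted geq la, all (leq 1) la & sumn la == n].

Definition cell (la : seq nat) : Type := {i : 'I_(size la) & 'I_(nth 0%N la i)}.

(* Coordinates start at 1. *)
Definition cell_row la (c : cell la) : nat := (tag c).+1.
Definition cell_col la (c : cell la) : nat := (tagged c).+1.

HB.instance Definition _ la :=
  Finite.copy (cell la) {i : 'I_(size la) & 'I_(nth 0%N la i)}.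

Section CellOrder.
Variable la : seq nat.
Implicit Types x y z : cell la.

Definition cell_le x y : bool := (cell_row x <= cell_row y)%N && (cell_col x <= cell_col y)%N.

Fact cell_le_refl : reflexive cell_le.
Proof. by move=> x; rewrite /cell_le !leqnn. Qed.

Fact cell_le_anti : antisymmetric cell_le.
Proof.
move=> [i j] [i' j']; rewrite /cell_le /cell_row /cell_col /= !ltnS => H.
have ii' : i = i'.
  by apply/val_inj/eqP; rewrite eqn_leq; case/andP: H => /andP[-> _] /andP[-> _].
subst i'; congr existT; apply/val_inj/eqP.
by rewrite eqn_leq; case/andP: H => /andP[_ ->] /andP[_ ->].
Qed.

Fact cell_le_trans : transitive cell_le.
Proof.
move=> y x z /andP[rxy cxy] /andP[ryz cyz].
by rewrite /cell_le (leq_trans rxy ryz) (leq_trans cxy cyz).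
Qed.

End CellOrder.

Fact cell_display : Order.disp_t. Proof. exact: Order.Disp tt tt. Qed.

HB.instance Definition _ la := Order.Le_isPOrder.Build cell_display (cell la)
  (@cell_le_refl la) (@cell_le_anti la) (@cell_le_trans la).

(* Main.v *)
Require Import Defs.
From mathcomp Require Import all_boot all_order all_algebra.
From mathcomp Require Import perm zify lra.

Set Implicit Arguments.
Unset Strict Implicit.
Unset Printing Implicit Defensive.

Import Order.TTheory GRing.Theory Num.Theory.

Local Open Scope ring_scope.

(** Take the chain [c 0 < c 1 < ...] to be the first row and [a] the cell (2,1), so that every cell
    off the chain is at least [a]. Let N count the linear extensions and e_i those with [c i] before
    [a]; then e_0 = N, and e_i decreases to 0 past the end of the chain. If [a] falls between [c i]
    and [c i.+1], it comes immediately after [c i], since nothing but chain elements can precede [a]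
    ([label_after_prefix]). Exchanging [a] with that immediate predecessor is injective and moves
    [a] one step down the chain, so the drops e_i - e_{i+1} are nonincreasing ([drops_noninc]).

    If e_1 >= N/2, let i >= 1 be least with e_i <= 2N/3. Either i = 1 and e_1 lies in [N/3, 2N/3],
    or e_1 >= e_{i-1} > 2N/3; then every drop is at most N - e_1 < N/3, so the sequence cannot jump
    over [N/3, 2N/3] ([balanced_chain_element]). If e_1 < N/2, the conjugate choice applies: the
    first column as chain and [a] = (1,2). *)

(** * Counting linear extensions and exchanging adjacent labels *)

Section LinearExtensions.
Context {d : Order.disp_t} {T : finPOrderType d}.
Implicit Types (x y z a b : T) (L : {ffun T -> 'I_#|T|}).

Definition linexts_lt x y := [set L | linear_extension L && (L x < L y)%N].

Lemma linear_extensionP L :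
  reflect [/\ injective L, (forall k, exists x, L x = k)
            & forall x y, (x < y)%O -> (L x < L y)%N]
          (linear_extension L).
Proof.
apply: (iffP and3P) => [[/injectiveP injL /forallP surL /forallP ltL]|].
  split=> // [k|x y xy]; first by have /codomP[x ->] := surL k; exists x.
  by have /forallP/(_ y)/implyP := ltL x; apply.
case=> injL surL ltL; split; first exact/injectiveP.
  by apply/forallP => k; have [x <-] := surL k; exact: codom_f.
by apply/forallP => x; apply/forallP => y; apply/implyP; exact: ltL.
Qed.

Lemma linear_extension_neq L x y :
  linear_extension L -> x != y -> L x != L y :> nat.
Proof.
by case/linear_extensionP => injL _ _; apply: contra => /eqP/val_inj/injL ->.
Qed.

Lemma card_linexts_lt x y : x != y ->
  (#|linexts_lt x y| + #|linexts_lt y x|)%N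
    = #|[set L : {ffun T -> 'I_#|T|} | linear_extension L]|.
Proof.
move=> xy; rewrite -(cardsID [set L : {ffun T -> 'I_#|T|} | (L x < L y)%N] [set L | linear_extension L]).
congr (_ + _)%N; apply: eq_card => L; rewrite !inE // andbC.
case leL: (linear_extension L); rewrite ?andbF //= !andbT.
by have := linear_extension_neq leL xy; case: ltngtP.
Qed.

Lemma delta_pairC x y : delta_pair x y = delta_pair y x.
Proof. exact: distrC. Qed.

(** If A of the N extensions put [x] first, the difference of probabilities is |2A - N|/N, which is
    at most 1/3 exactly when A lies in [N/3, 2N/3]. *)
Lemma delta_pair_le_third x y (N := #|[set L : {ffun T -> 'I_#|T|} | linear_extension L]|) :
  x != y -> (N <= 3 * #|linexts_lt x y| <= 2 * N)%N ->
  delta_pair x y <= 1 / 3%:R.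
Proof.
move=> xy /andP[]; rewrite /delta_pair /prob_linext.
have := card_linexts_lt xy; rewrite -/(linexts_lt x y) -/(linexts_lt y x) -/N.
move: #|_| #|_| N => A B N eN leN geN.
(* No existence of linear extensions is needed here: for N = 0 both quotients are 0 by the
   convention on division by zero. *)
have [->|N0] := posnP N; first by rewrite !invr0 !mulr0 subrr normr0.
have N0' : 0 < N%:R :> rat by rewrite ltr0n.
rewrite -mulrBl normrM normfV (gtr0_norm N0') ler_pdivrMr //.
rewrite -(ler_nat rat) in leN; rewrite -(ler_nat rat) in geN.
move: leN geN eN; rewrite !natrM => leN geN /(congr1 (fun k => k%:R : rat)).
rewrite natrD => eN; rewrite ler_norml; lra.
Qed.

Lemma delta_le_pair x y : x != y -> delta T <= delta_pair x y.
Proof. by move=> xy; rewrite /delta; apply: (bigmin_le_cond _ (j := (x, y))). Qed.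

Definition swap_labels a b L : {ffun T -> 'I_#|T|} := [ffun x => L (tperm a b x)].

Lemma swap_labels_inj a b : injective (swap_labels a b).
Proof.
move=> L L' /ffunP eLL'; apply/ffunP => x.
by have := eLL' (tperm a b x); rewrite !ffunE tpermK.
Qed.

(** Exchanging consecutive labels alters only the relative order of [a] and [b], and that pair is
    not constrained. *)
Lemma swap_labels_linear_extension a b L :
  linear_extension L -> ~~ (a < b)%O -> L b = (L a).+1 :> nat ->
  linear_extension (swap_labels a b L).
Proof.
move=> leL nab eLb; have neqL := linear_extension_neq leL.
have /linear_extensionP[injL surL ltL] := leL.
apply/linear_extensionP; split=> [x y|k|x y xy].
- by rewrite !ffunE => /injL/perm_inj.
- by have [x <-] := surL k; exists (tperm a b x); rewrite ffunE tpermK.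
have := ltL _ _ xy; rewrite !ffunE.
case: tpermP => [xa|xb|xa xb]; case: tpermP => [ya|yb|ya yb]; subst=> //; try lia.
- by have := neqL y b; move/eqP: yb => /[swap] /[apply]; lia.
- by have := neqL x a; move/eqP: xa => /[swap] /[apply]; lia.
Qed.

End LinearExtensions.

(** * A chain together with the up-set of one element *)

Section ChainBelowFilter.
Context {d : Order.disp_t} {T : finPOrderType d}.
Implicit Types L : {ffun T -> 'I_#|T|}.
Variables (m : nat) (c : nat -> T) (a : T).
Hypothesis m_gt1 : (1 < m)%N.
Hypothesis c_lt : forall i j, (i < j < m)%N -> (c i < c j)%O.
Hypothesis c0_lt : (c 0%N < a)%O.
Hypothesis c_inc : forall i, (0 < i < m)%N -> ~~ (c i >=< a)%O.
Hypothesis c_cover : forall z, (a <= z)%O \/ exists2 i, (i < m)%N & z = c i.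

Let N := #|[set L : {ffun T -> 'I_#|T|} | linear_extension L]|.
                                                                   
(** The guard makes [E i] empty for [i >= m], where the values of [c] are meaningless, so the
    cardinals run from N down to 0. *)
Let E i := [set L in linexts_lt (c i) a | (i < m)%N].

Lemma c_neq i : (i < m)%N -> c i != a.
Proof.
case: i => [|i] im; first by rewrite lt_eqF.
by have := c_inc (i := i.+1) im; apply: contra => /eqP ->; exact: comparablexx.
Qed.

Lemma prefixes_subset i : E i.+1 \subset E i.
Proof.
apply/subsetP => L; rewrite !inE => /andP[/andP[leL lt_ca] im].
rewrite leL (ltnW im) !andbT /=; have /linear_extensionP[_ _ ltL] := leL.
by apply: ltn_trans (ltL _ _ _) lt_ca; rewrite c_lt // ltnSn.
Qed.

Lemma prefixes0 : #|E 0| = N.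
Proof.
apply: eq_card => L; rewrite !inE; case leL: (linear_extension L) => //=.
by have /linear_extensionP[_ _ ltL] := leL; rewrite ltL // (ltnW m_gt1).
Qed.

Lemma prefixes_end : #|E m| = 0%N.
Proof. by apply: eq_card0 => L; rewrite !inE ltnn andbF. Qed.

(** The element [z] with the label just after [c i] must be [a]. An element strictly above [a] would
    come too late, and a later chain element would put [c i.+1] before [a], contrary to the choice
    of [L]. *)
Lemma label_after_prefix i L :
  L \in E i :\: E i.+1 -> L a = (L (c i)).+1 :> nat.
Proof.
rewrite !inE => /andP[notS /andP[/andP[leL lt_ca] im]].
have /linear_extensionP[injL surL ltL] := leL; rewrite leL /= in notS.
have ltT : ((L (c i)).+1 < #|T|)%N by apply: leq_trans (ltn_ord (L a)).
have [z /(congr1 val) /= Lz] := surL (Ordinal ltT).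
have [|[j jm zj]] := c_cover z.
  by rewrite le_eqVlt => /orP[/eqP -> //|/ltL]; rewrite Lz ltnS leqNgt lt_ca.
have [ji|ij|ji] := ltngtP j i.
- have /ltL : (c j < c i)%O by rewrite c_lt // ji.
  by rewrite -zj Lz ltnNge leqnSn.
- have im1 : (i.+1 < m)%N by exact: leq_ltn_trans ij jm.
  rewrite im1 andbT -leqNgt in notS.
  have Lcz : (L (c i.+1) <= L z)%N.
    rewrite zj; have [->|ne] := eqVneq i.+1 j; first exact: leqnn.
    by apply/ltnW/ltL/c_lt; lia.
  have /eqP[] := linear_extension_neq leL (c_neq im1).
  by apply/eqP; rewrite eqn_leq notS andbT; apply: leq_trans Lcz _; rewrite Lz.
- by move: Lz; rewrite zj ji => /n_Sn.
Qed.

(** When [a] immediately follows [c i.+1], exchanging the two leaves [a] between [c i] and [c i.+1];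
    this exchange is injective. *)
Lemma drops_noninc i : (#|E i.+1 :\: E i.+2| <= #|E i :\: E i.+1|)%N.
Proof.
rewrite -(card_imset _ (@swap_labels_inj _ T (c i.+1) a)).
apply/subset_leq_card/subsetP => _ /imsetP[L LD ->].
have La := label_after_prefix LD; move: LD.
rewrite inE => /andP[_]; rewrite !inE => /andP[/andP[leL lt_ca] im].
have cc : (c i < c i.+1)%O by rewrite c_lt // ltnSn.
have /linear_extensionP[_ _ ltL] := leL.
rewrite swap_labels_linear_extension //; last first.
  by have := c_inc (i := i.+1) im; apply: contra => /lt_comparable.
rewrite !ffunE tpermL tpermR tpermD; first by rewrite /= (ltL _ _ cc) (ltnW im) ltnNge (ltnW lt_ca).
  by rewrite gt_eqF.
by rewrite eq_sym c_neq // ltnW.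
Qed.

Lemma balanced_chain_element :
  (N <= 2 * #|linexts_lt (c 1%N) a|)%N ->
  exists2 i, (i < m)%N & delta_pair (c i) a <= 1 / 3%:R.
Proof.
have EE i : (i < m)%N -> #|E i| = #|linexts_lt (c i) a|.
  by move=> im; apply: eq_card => L; rewrite !inE im andbT.
rewrite -EE // => half.
have drop i : (#|E i| = #|E i.+1| + #|E i :\: E i.+1|)%N.
  by rewrite -(cardsID (E i.+1) (E i)) (setIidPr (prefixes_subset i)).
have drop0 i : (#|E i :\: E i.+1| <= N - #|E 1|)%N.
  elim: i => [|i IHi]; first by have := drop 0%N; rewrite prefixes0; lia.
  exact: leq_trans (drops_noninc i) IHi.
have le_E1 i : (#|E i.+1| <= #|E 1|)%N.
  by elim: i => // i; apply: leq_trans; exact/subset_leq_card/prefixes_subset.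
(* The index [m] witnesses existence, as [E m] is empty. *)
have [|i /andP[i0 Ei] imin] := ex_minnP (P := fun i => (0 < i)%N && (3 * #|E i| <= 2 * N)%N).
  by exists m; rewrite prefixes_end muln0 (ltnW m_gt1).
have im : (i <= m)%N by apply: imin; rewrite prefixes_end muln0 (ltnW m_gt1).
have third : (N <= 3 * #|E i|)%N /\ (i < m)%N.
  (* For index 1 the assumption [half] suffices. Otherwise minimality puts the previous cardinal
     above 2N/3, and the drop is below N/3. *)
  case: i i0 Ei imin im => [//|[|i]] _ Ei imin im; first by split=> //; lia.
  have big : (2 * N < 3 * #|E i.+1|)%N.
    by rewrite ltnNge; apply/negP => small; have := imin i.+1; rewrite small => /(_ isT); lia.
  have := drop i.+1; have := drop0 i.+1; have := le_E1 i => e1 e2 e3.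
  (* If the least index were [m], the last drop would be the whole of [E i.+1], both above 2N/3 and
     below N/3. *)
  have [||eim] := ltngtP i.+2 m; [by split=> //; lia | by lia |].
  by have := prefixes_end; rewrite -eim; lia.
have [third1 im'] := third.
by exists i => //; apply: delta_pair_le_third; rewrite ?c_neq // -EE // third1.
Qed.

End ChainBelowFilter.

(** * The first row and first column of a Young diagram *)

Section YoungDiagram.
Variable la : seq nat.
Implicit Types z : cell la.

Lemma cell_leE z z' : (z <= z')%O = (cell_row z <= cell_row z')%N && (cell_col z <= cell_col z')%N.
Proof. by []. Qed.

Lemma cell_ltE z z' : (z < z')%O =
  [&& (cell_row z <= cell_row z')%N, (cell_col z <= cell_col z')%N
    & (cell_row z < cell_row z')%N || (cell_col z < cell_col z')%N].
Proof. by rewrite lt_leAnge !cell_leE; lia. Qed.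

Lemma cell_inj z z' :
  cell_row z = cell_row z' -> cell_col z = cell_col z' -> z = z'.
Proof. by move=> er ec; apply: le_anti; rewrite !cell_leE er ec !leqnn. Qed.

Lemma cell_bounds z : [/\ (0 < cell_row z <= size la)%N, (0 < cell_col z)%N
  & (cell_col z <= nth 0%N la (cell_row z).-1)%N].
Proof. by rewrite /cell_row /cell_col /= !ltn_ord. Qed.

Lemma cell_exists i j : (i < size la)%N -> (j < nth 0%N la i)%N ->
  exists z, cell_row z = i.+1 /\ cell_col z = j.+1.
Proof.
move=> isz jla.
by exists (existT (fun i : 'I_(size la) => 'I_(nth 0%N la i)) (Ordinal isz) (Ordinal jla)).
Qed.

Hypothesis la_sorted : sorted geq la.
Hypothesis la_pos : all (leq 1) la.

Lemma nth_le_head i : (nth 0%N la i <= head 0%N la)%N.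
Proof.
have [sz|sz] := ltnP i (size la); last by rewrite nth_default.
have geq_trans : transitive geq by move=> x y z /= yx xz; exact: leq_trans xz yx.
have := sorted_leq_nth geq_trans leqnn 0%N la_sorted 0%N i.
by rewrite !inE nth0; apply=> //; lia.
Qed.

Lemma not_chain_shape : ~ chain (cell la) ->
  (1 < size la)%N /\ (1 < head 0%N la)%N.
Proof.
move=> nch; split; rewrite ltnNge; apply/negP => le1; apply: nch => z z';
  have [rz cz cz'] := cell_bounds z; have [rz' dz dz'] := cell_bounds z';
  rewrite /Order.comparable !cell_leE.
  by lia.
by have := nth_le_head (cell_row z).-1; have := nth_le_head (cell_row z').-1; lia.
Qed.

Lemma row_chain : (0 < size la)%N -> (0 < head 0%N la)%N ->
  exists c : nat -> cell la, forall i, (i < head 0%N la)%N ->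
    cell_row (c i) = 1%N /\ cell_col (c i) = i.+1.
Proof.
move=> sz hd.
have H (i : 'I_(head 0%N la)) : exists z, (cell_row z == 1%N) && (cell_col z == i.+1).
  have [|z [rz cz]] := cell_exists (i := 0) (j := i) sz _; first by rewrite nth0.
  by exists z; rewrite rz cz !eqxx.
(* Indices past the end of the row are sent to the corner cell by the default of [insubd]; this
   makes the chain a total function on [nat]. *)
exists (fun i => xchoose (H (insubd (Ordinal hd) i))) => i ih.
have /andP[/eqP-> /eqP->] := xchooseP (H (insubd (Ordinal hd) i)).
by rewrite val_insubd ih.
Qed.

Lemma col_chain : (0 < size la)%N ->
  exists c : nat -> cell la, forall i, (i < size la)%N ->
    cell_row (c i) = i.+1 /\ cell_col (c i) = 1%N.
Proof.
move=> sz.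
have H (i : 'I_(size la)) : exists z, (cell_row z == i.+1) && (cell_col z == 1%N).
  have [|z [rz cz]] := cell_exists (i := i) (j := 0) (ltn_ord i).
    exact: (all_nthP 0%N la_pos).
  by exists z; rewrite rz cz !eqxx.
exists (fun i => xchoose (H (insubd (Ordinal sz) i))) => i ih.
have /andP[/eqP-> /eqP->] := xchooseP (H (insubd (Ordinal sz) i)).
by rewrite val_insubd ih.
Qed.

Lemma first_row_column_pair : ~ chain (cell la) ->
  exists x y : cell la,
    [/\ cell_row x = 1%N, cell_col y = 1%N, x != y & delta_pair x y <= 1 / 3%:R].
Proof.
case/not_chain_shape => sz hd.
have [r rE] := row_chain (ltnW sz) (ltnW hd).
have [c cE] := col_chain (ltnW sz).
have [r1r r1c] := rE _ hd; have [c1r c1c] := cE _ sz.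
have rc : r 1%N != c 1%N by apply/eqP => e; move: r1r; rewrite e c1r.
have tot := card_linexts_lt rc.
(* The cells (1,2) and (2,1) are compared: the one more often first determines the chain, row or
   column, and the other one serves as [a]. *)
have [half|half] := leqP #|linexts_lt (c 1%N) (r 1%N)| #|linexts_lt (r 1%N) (c 1%N)|.
- have [i j|||z||i im di] := @balanced_chain_element _ _ (head 0%N la) r (c 1%N) hd.
  + move=> /andP[ij jm]; have [? ?] := rE _ jm; have [? ?] := rE _ (ltn_trans ij jm).
    by rewrite cell_ltE; lia.
  + by have [? ?] := rE _ (ltnW hd); rewrite cell_ltE; lia.
  + move=> i /andP[i0 im]; have [? ?] := rE _ im.
    by rewrite /Order.comparable !cell_leE; lia.
  + have [rz cz czn] := cell_bounds z.
    (* A cell outside the first row has row at least 2 and column at least 1, hence lies above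
       (2,1). *)
    have [r1|r1] := eqVneq (cell_row z) 1%N; last by left; rewrite cell_leE; lia.
    rewrite r1 nth0 in czn; have lt : ((cell_col z).-1 < head 0%N la)%N by lia.
    by right; exists (cell_col z).-1 => //; have [? ?] := rE _ lt; apply: cell_inj; lia.
  + by rewrite -tot; lia.
  exists (r i), (c 1%N); have [ri ?] := rE _ im; split=> //.
  by apply/eqP => e; move: ri; rewrite e c1r.
- have [i j|||z||i im di] := @balanced_chain_element _ _ (size la) c (r 1%N) sz.
  + move=> /andP[ij jm]; have [? ?] := cE _ jm; have [? ?] := cE _ (ltn_trans ij jm).
    by rewrite cell_ltE; lia.
  + by have [? ?] := cE _ (ltnW sz); rewrite cell_ltE; lia.
  + move=> i /andP[i0 im]; have [? ?] := cE _ im.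
    by rewrite /Order.comparable !cell_leE; lia.
  + have [rz cz czn] := cell_bounds z.
    have [r1|r1] := eqVneq (cell_col z) 1%N; last by left; rewrite cell_leE; lia.
    have lt : ((cell_row z).-1 < size la)%N by lia.
    by right; exists (cell_row z).-1 => //; have [? ?] := cE _ lt; apply: cell_inj; lia.
  + by rewrite -tot; lia.
  exists (r 1%N), (c i); have [? ci] := cE _ im; split=> //; last by rewrite delta_pairC.
  by apply/eqP => e; move: r1c; rewrite e ci.
Qed.

End YoungDiagram.

Theorem theorem3p1 (n : nat) (la : seq nat) :
  partition_of n la ->
  ~ chain (cell la) ->
  delta (cell la) <= 1 / 3%:R /\
  exists x y : cell la,
    [/\ cell_row x = 1%N, cell_col y = 1%N, x != y & delta_pair x y <= 1 / 3%:R].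
Proof.
case/and3P => la_sorted la_pos _ nch.
have [x [y [rx cy xy dxy]]] := first_row_column_pair la_sorted la_pos nch.
by split; [exact: le_trans (delta_le_pair xy) dxy | exists x, y].
Qed.
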